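(* Consider the collision-channel network with 2 CUs, 2 eRRHs and 2 CPs under an oblivious stationary randomized (OSR) policy with parameters $b_k^{(n)}$, $r_k$ satisfying $b_k^{(1)}+b_k^{(2)}=1$ for $k\in\{1,2\}$, and put $\zeta_{nk}^c=b_k^{(n)}(1-b_k^{(n)})$. Then the closed-form expression for the average AoI of the eRRHs is $$L_e=\frac12\sum_{n=1}^{2}\sum_{k=1}^{2}\frac{1}{r_k\zeta_{nk}^c}.$$
   Context: Time is slotted, $t=0,1,2,\dots$; $m,n,k\in\{1,2\}$ index content users (CUs), eRRHs and content providers (CPs). An OSR policy is given by $b_k^{(n)}\in[0,1]$ and $r_1\ge r_2$ in $[0,1]$. In slot $t$, $\beta_{mk}^{(n)}(t)\in\{0,1\}$ indicates that CU $m$ sends a request for CP $k$ to eRRH $n$; $\sum_n\beta_{mk}^{(n)}(t)\le1$, $\Pr(\beta_{mk}^{(n)}(t)=1)=b_k^{(n)}$ for all $m,t$, and decisions of different CUs $m$ are independent. When eRRH $n$ receives a request for CP $k$, it commands CP $k$ to send a new packet ($\gamma_{nk}(t)=1$) with probability $r_k$ and otherwise uses its cached packet ($\gamma_{nk}(t)=0$); the $\gamma_{nk}(t)$ are independent over $n$ and over $k$. Collisions: when two CUs simultaneously request the same CP from the same eRRH a collision occurs, so a request for CP $k$ is successfully received at an eRRH only if it is issued by a single CU; requests for different CPs at the same eRRH do not collide. AoI at the eRRHs: $g_{nk}(0)=1$; $g_{nk}(t+1)=1$ if $\gamma_{nk}(t)\sum_m\beta_{mk}^{(n)}(t)=1$,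 and $g_{nk}(t+1)=g_{nk}(t)+1$ otherwise. The average AoI of the eRRHs is $L_e=\lim_{T\to\infty}\frac1T\sum_{t=1}^T\frac14\sum_{n=1}^{2}\sum_{k=1}^{2}\mathbb{E}[g_{nk}(t)]$.
   Formalization: The printed formula is four times too large for L_e as defined with weight 1/4 (r_k=1, all b=1/2: L_e=2, formula gives 8); the theorem proved is L_e = (1/4)·(1/2) ΣΣ 1/(r_k ζ_nk), with value +∞ when some r_k ζ_nk = 0. *)

(* Defs.v *)
(* MathComp-Analysis *)
From HB Require Import structures.
From mathcomp Require Export all_boot all_order all_algebra.
From mathcomp Require Export all_classical all_reals all_analysis.

Set Implicit Arguments.
Unset Strict Implicit.
Unset Printing Implicit Defensive.

Import Order.TTheory GRing.Theory Num.Theory.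
Import numFieldNormedType.Exports.

Local Open Scope classical_set_scope.
Local Open Scope ring_scope.

(* CUs, eRRHs and CPs are numbered 0, 1 instead of 1, 2. *)
Definition CU := 'I_2.
Definition eRRH := 'I_2.
Definition CP := 'I_2.

(* The events determined by a discrete (e.g. finitely valued) X. *)
Definition events_of (T V : Type) (X : T -> V) : set (set T) :=
  [set X @^-1` B | B in [set: set V]].

Definition mutually_independent (d : measure_display) (T : measurableType d)
    (R : realType) (P : probability T R) (I : eqType)
    (G : I -> set (set T)) : Prop :=
  forall (s : seq I) (A : I -> set T), uniq s ->
    (forall i, i \in s -> G i (A i)) ->
    P (\big[setI/[set: T]]_(i <- s) A i) = (\prod_(i <- s) P (A i))%E.

Section Network.
Context (d : measure_display) (T : measurableType d) (R : realType).
Variable P : probability T R.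

(* beta m n k t w : CU m sends a request for CP k to eRRH n in slot t. *)
Variable beta : CU -> eRRH -> CP -> nat -> T -> bool.

(* gamma n k t w : the decision of eRRH n about CP k in slot t.  It is a coin
   tossed in every slot; it has an effect (on AoI below) only in the slots in
   which a request for CP k is successfully received at eRRH n. *)
Variable gamma : eRRH -> CP -> nat -> T -> bool.

(* The whole decision of CU m in slot t, for all eRRHs and CPs. *)
Definition CU_decision (m : CU) (t : nat) (w : T) : {ffun eRRH * CP -> bool} :=
  [ffun nk => beta m nk.1 nk.2 t w].

(* The sources of randomness: in each slot, the decision of each CU and the
   decision of each eRRH about each CP. *)
Definition source_events (i : (CU + eRRH * CP) * nat) : set (set T) :=
  match i.1 with
  | inl m => events_of (CU_decision m i.2)
  | inr nk => events_of (gamma nk.1 nk.2 i.2)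
  end.

(* The joint law of the requests of one CU for the two different CPs in a slot
   is left unspecified. *)
Record OSR_policy (b : CP -> eRRH -> R) (r : CP -> R) : Prop := {
  osr_b01 : forall k n, 0 <= b k n <= 1 ;
  osr_r01 : forall k, 0 <= r k <= 1 ;
  osr_r_order : r ord_max <= r ord0 ;
  osr_beta_measurable : forall m n k t, measurable [set w | beta m n k t w] ;
  osr_gamma_measurable : forall n k t, measurable [set w | gamma n k t w] ;
  osr_one_eRRH : forall m k t w, (\sum_(n < 2) beta m n k t w <= 1)%N ;
  osr_beta : forall m n k t, P [set w | beta m n k t w] = (b k n)%:E ;
  osr_gamma : forall n k t, P [set w | gamma n k t w] = (r k)%:E ;
  osr_independent : mutually_independent P source_events
}.

(* The collision rule: the request for CP k is received at eRRH n only when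
   exactly one CU has issued it. *)
Fixpoint AoI (n : eRRH) (k : CP) (t : nat) (w : T) : nat :=
  match t with
  | 0 => 1
  | t'.+1 =>
      if (gamma n k t' w * \sum_(m < 2) beta m n k t' w == 1)%N then 1
      else (AoI n k t' w).+1
  end.

Local Open Scope ereal_scope.

(* The time average over the slots 1, ..., N. *)
Definition mean_AoI (N : nat) : \bar R :=
  (N%:R^-1)%:E * \sum_(1 <= t < N.+1)
    ((4^-1)%:E * \sum_(n < 2) \sum_(k < 2) 'E_P[fun w => (AoI n k t w)%:R]).

Definition average_AoI : \bar R := limn mean_AoI.

End Network.

(* Exactly one CU requests CP k from eRRH n with probability 2 zeta_c, so g_nk
   has limiting mean 1 / (2 r_k zeta_c); mean_AoI then carries the weight 1/4.
   Omitting that weight would give the expression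
   1/2 \sum_n \sum_k 1 / (r_k zeta_c), which is four times the average AoI.
   Degenerate parameters are covered by the inverse of \bar R, 0^-1 = +oo. *)
Definition zeta_c (R : realType) (b : CP -> eRRH -> R) (n : eRRH) (k : CP) : R :=
  b k n * (1 - b k n).

(* Main.v *)
(* With probability p = 2 r_k zeta_nk exactly one CU requests CP k from eRRH n
   and is served a new packet, independently over the slots.  The AoI exceeds j
   precisely when the last j slots all exist and none of them was a success, so
   E[g_nk(t)] is the partial geometric sum of (1 - p)^j over j <= t.  It tends to
   1 / p (to +oo when p = 0), and so does its Cesaro mean. *)
Require Import Defs.
From mathcomp Require Import all_boot all_order all_algebra.
From mathcomp Require Import all_classical all_reals all_analysis.
From mathcomp Require Import measurable_realfun ring lra.
Import Order.TTheory GRing.Theory Num.Theory.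
Import numFieldNormedType.Exports.

Set Implicit Arguments.
Unset Strict Implicit.
Unset Printing Implicit Defensive.

Local Open Scope classical_set_scope.
Local Open Scope ring_scope.

(** * Events built from independent sources *)

Section Sources.
Context {d : measure_display} {T : measurableType d} {R : realType}.
Variables (P : probability T R).
Variables (beta : CU -> eRRH -> CP -> nat -> T -> bool).
Variables (gamma : eRRH -> CP -> nat -> T -> bool).

Definition source := ((CU + eRRH * CP) * nat)%type.

(* F depends on the sources in u only, through one event for each of them. *)
Definition cylinder (u : seq source) (F : set T) (x : R) : Prop :=
  [/\ uniq u, measurable F, P F = x%:E &
    exists2 A : source -> set T,
      forall i, i \in u -> source_events beta gamma i (A i) &
      F = \big[setI/[set: T]]_(i <- u) A i].

Lemma cylinder_setT : cylinder [::] [set: T] 1.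
Proof.
split=> //; first exact: probability_setT.
by exists (fun=> [set: T]) => //; rewrite big_nil.
Qed.

(** Since [i] is fresh, mutual independence applies to [i :: u] as well as to [u]: the product over
    [u] is [x], and the longer one has the extra factor [P E]. *)
Lemma cylinder_cons (u : seq source) (F : set T) (x : R)
    (i : source) (E : set T) (y : R) :
    mutually_independent P (source_events beta gamma) ->
    i \notin u -> source_events beta gamma i E -> measurable E ->
    P E = y%:E -> cylinder u F x ->
  cylinder (i :: u) (E `&` F) (y * x).
Proof.
move=> indep iu iE mE PE [uu mF PF [A sA FE]].
(* Nothing is required of [A] at [i], which lies outside [u], so its value there can be replaced by
   [E]. *)
pose A' z := if z == i then E else A z.
have A'i : A' i = E by rewrite /A' eqxx.
have A'u z : z \in u -> A' z = A z.
  by move=> zu; rewrite /A'; case: eqVneq zu iu => // -> ->.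
have uiu : uniq (i :: u) by rewrite /= iu.
have sA' z : z \in i :: u -> source_events beta gamma z (A' z).
  rewrite inE; have [->|_ /= zu] := eqVneq z i; first by rewrite A'i.
  by rewrite A'u //; exact: sA.
have EF : E `&` F = \big[setI/[set: T]]_(z <- i :: u) A' z.
  by rewrite big_cons A'i FE; congr (_ `&` _); apply: eq_big_seq => z /A'u.
split=> //; first exact: measurableI.
  rewrite EF (indep _ _ uiu sA') big_cons A'i PE EFinM -PF FE (indep _ _ uu sA).
  by congr (_ * _)%E; apply: eq_big_seq => z /A'u ->.
by exists A'.
Qed.

End Sources.

(** * Successful receptions and runs of slots without any *)

Section Reception.
Context {d : measure_display} {T : measurableType d} {R : realType}.
Variables (P : probability T R).
Variables (beta : CU -> eRRH -> CP -> nat -> T -> bool).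
Variables (gamma : eRRH -> CP -> nat -> T -> bool).
Variables (b : CP -> eRRH -> R) (r : CP -> R).
Hypothesis policy : OSR_policy P beta gamma b r.
Variables (n : eRRH) (k : CP).

Definition requested (c : bool) (m : CU) (t : nat) : set T :=
  [set w | beta m n k t w = c].

Definition commanded (t : nat) : set T := [set w | gamma n k t w].

(* [lift m ord0] is the CU other than m. *)
Definition received_from (m : CU) (t : nat) : set T :=
  commanded t `&` (requested true m t `&` requested false (lift m ord0) t).

Definition success (t : nat) : set T :=
  received_from ord0 t `|` received_from (lift ord0 ord0) t.

Definition success_prob : R := 2 * (r k * zeta_c b n k).

(** The window consists of the slots t to t + j - 1. Its earliest slot is peeled first, so that an
    induction on j moves forward in time from an event of the past. *)
Fixpoint no_success (t j : nat) : set T :=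
  if j is j'.+1 then ~` success t `&` no_success t.+1 j' else [set: T].

Lemma requested_event (c : bool) (m : CU) (t : nat) :
  source_events beta gamma (inl m, t) (requested c m t).
Proof.
exists [set f | f (n, k) = c] => //.
by apply/seteqP; split=> w /=; rewrite /requested /= ffunE.
Qed.

Lemma commanded_event (t : nat) :
  source_events beta gamma (inr (n, k), t) (commanded t).
Proof. by exists [set x | x]. Qed.

Lemma requestedN (m : CU) (t : nat) :
  requested false m t = ~` [set w | beta m n k t w].
Proof. by apply/seteqP; split=> w; rewrite /requested /=; case: beta. Qed.

Lemma measurable_requested (c : bool) (m : CU) (t : nat) :
  measurable (requested c m t).
Proof.
case: c; first exact: (osr_beta_measurable policy).
by rewrite requestedN; apply/measurableC/(osr_beta_measurable policy).
Qed.

Lemma prob_requested (c : bool) (m : CU) (t : nat) :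
  P (requested c m t) = (if c then b k n else 1 - b k n)%:E.
Proof.
case: c; first exact: (osr_beta policy).
rewrite requestedN probability_setC ?(osr_beta policy) //.
exact: (osr_beta_measurable policy).
Qed.

(** All sources in [u] precede slot t, so three sources of slot t are fresh: the coin of the eRRH,
    CU [m] and the other CU. They contribute the factors r, b and 1 - b. The slot bound t + 1 allows
    the same extension in later slots. *)
Lemma cylinder_received (u : seq source) (F : set T) (x : R)
    (m : CU) (t : nat) :
    all (fun i : source => i.2 < t)%N u -> cylinder P beta gamma u F x ->
  exists2 v : seq source, all (fun i : source => i.2 < t.+1)%N v &
    cylinder P beta gamma v (received_from m t `&` F)
      (r k * zeta_c b n k * x).
Proof.
move=> ut cF; have indep := osr_independent policy.
have fresh s : (s, t) \notin u.
  by apply/negP => /(allP ut) /=; rewrite ltnn.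
exists [:: (inr (n, k), t), (inl m, t), (inl (lift m ord0), t) & u].
  by rewrite /= ltnSn /=; apply: sub_all ut => i /ltnW.
have c1 := cylinder_cons indep (fresh _) (requested_event false (lift m ord0) t)
  (measurable_requested _ _ _) (prob_requested _ _ _) cF.
have fresh1 : (inl m, t) \notin (inl (lift m ord0), t) :: u.
  rewrite inE negb_or fresh andbT xpair_eqE eqxx andbT.
  by apply/eqP => -[] /eqP; rewrite (negbTE (neq_lift _ _)).
have c2 := cylinder_cons indep fresh1 (requested_event true m t)
  (measurable_requested _ _ _) (prob_requested _ _ _) c1.
have -> : received_from m t `&` F = commanded t `&`
  (requested true m t `&` (requested false (lift m ord0) t `&` F)).
  by rewrite /received_from !setIA.
have -> : r k * zeta_c b n k * x = r k * (b k n * ((1 - b k n) * x)).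
  by rewrite /zeta_c; ring.
apply: cylinder_cons => //.
- by rewrite !inE !negb_or fresh.
- exact: commanded_event.
- exact: (osr_gamma_measurable policy).
- exact: (osr_gamma policy).
Qed.

Lemma measurable_received (m : CU) (t : nat) : measurable (received_from m t).
Proof.
apply: measurableI; first exact: (osr_gamma_measurable policy).
by apply: measurableI; exact: measurable_requested.
Qed.

Lemma measurable_success (t : nat) : measurable (success t).
Proof. by apply: measurableU; exact: measurable_received. Qed.

Lemma measurable_no_success (t j : nat) : measurable (no_success t j).
Proof.
elim: j t => [|j IH] t /=; first exact: measurableT.
by apply: measurableI => //; exact/measurableC/measurable_success.
Qed.

(* A success in slot t is a disjoint union of two cylinders, so intersecting
   with its complement amounts to subtracting two instances of the same formula
   for the slots after t. *)
Lemma prob_cylinder_no_success (j t : nat)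
    (u : seq source) (F : set T) (x : R) :
    all (fun i : source => i.2 < t)%N u -> cylinder P beta gamma u F x ->
  P (F `&` no_success t j) = (x * (1 - success_prob) ^+ j)%:E.
Proof.
elim: j t u F x => [|j IH] t u F x ut cF /=.
  by rewrite setIT expr0 mulr1; case: cF.
have mF : measurable F by case: cF.
(* The induction hypothesis is used for [F] extended by a reception in slot t, which is why the
   cylinder is kept arbitrary. *)
have received m : P (received_from m t `&` F `&` no_success t.+1 j) =
    (r k * zeta_c b n k * x * (1 - success_prob) ^+ j)%:E.
  have [v vt cv] := cylinder_received m ut cF.
  exact: IH vt cv.
have unconditioned :
    P (F `&` no_success t.+1 j) = (x * (1 - success_prob) ^+ j)%:E.
  by apply: IH cF; apply: sub_all ut => i /ltnW.
have mN := measurable_no_success t.+1 j.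
have mR m : measurable (received_from m t `&` F `&` no_success t.+1 j).
  by do 2 apply: measurableI => //; exact: measurable_received.
set N := no_success t.+1 j in received unconditioned mN mR *.
set R0 := received_from ord0 t `&` F `&` N.
set R1 := received_from (lift ord0 ord0) t `&` F `&` N.
have FN : F `&` N = F `&` (~` success t `&` N) `|` (R0 `|` R1).
  apply/seteqP; split=> w; rewrite /R0 /R1 /success /=; last by tauto.
  case=> Fw Nw.
  have [|] := pselect (received_from ord0 t w);
    have [|] := pselect (received_from (lift ord0 ord0) t w); tauto.
(* CU 0 issues the request in [R0] and is silent in [R1]. *)
have R01 : R0 `&` R1 = set0.
  apply/seteqP; split=> // w [] [[[_ [b0 _]] _] _] [[[_ [_ b0']] _] _].
  have l0 : lift (lift ord0 ord0) ord0 = ord0 :> CU by apply: val_inj.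
  by move: b0'; rewrite /requested /= l0 b0.
have dis : F `&` (~` success t `&` N) `&` (R0 `|` R1) = set0.
  by apply/seteqP; split=> // w; rewrite /R0 /R1 /success /=; tauto.
have mfail : measurable (F `&` (~` success t `&` N)).
  apply: measurableI => //; apply: measurableI => //.
  exact/measurableC/measurable_success.
have PFN : P (F `&` N) = (P (F `&` (~` success t `&` N)) + (P R0 + P R1))%E.
  rewrite FN -(measureU P (mR _) (mR _) R01).
  by apply: measureU => //; apply: measurableU; exact: mR.
move: PFN; rewrite unconditioned /R0 /R1 !received.
(* Every probability here is finite, so the identity descends to the reals, where the reception
   terms can be cancelled. *)
have /fineK <- := fin_num_measure P _ mfail.
rewrite -!EFinD => -[e]; congr EFin.
apply: (addIr (r k * zeta_c b n k * x * (1 - success_prob) ^+ j +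
  r k * zeta_c b n k * x * (1 - success_prob) ^+ j)).
by rewrite -e exprS {2}/success_prob; ring.
Qed.

Lemma prob_no_success (t j : nat) :
  P (no_success t j) = ((1 - success_prob) ^+ j)%:E.
Proof.
rewrite -[no_success t j]setTI -[_ ^+ _]mul1r.
exact: (prob_cylinder_no_success j (u := [::]) isT (cylinder_setT _ _ _)).
Qed.

Lemma success_prob_ge0 : 0 <= success_prob.
Proof.
have /andP[b0 b1] := osr_b01 policy k n; have /andP[r0 _] := osr_r01 policy k.
by rewrite mulr_ge0 // mulr_ge0 // mulr_ge0 // subr_ge0.
Qed.

(** The complement to 1 is itself a probability, that of no success in a single slot. *)
Lemma success_prob_le1 : success_prob <= 1.
Proof.
have := prob_no_success 0 1; rewrite expr1 => e.
by rewrite -subr_ge0 -lee_fin -e.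
Qed.

(** * The age as a sum of indicators, and its expectation *)

Lemma no_successSr (t j : nat) :
  no_success t j.+1 = no_success t j `&` ~` success (t + j)%N.
Proof.
elim: j t => [|j IH] t; first by rewrite /= addn0 setIC.
by rewrite -/(no_success t j.+1) /= -/(no_success t.+1 j.+1) IH addSnnS setIA.
Qed.

Lemma successE (t : nat) :
  success t =
    [set w | gamma n k t w &&
             (beta ord0 n k t w (+) beta (lift ord0 ord0) n k t w)].
Proof.
have l0 : lift (lift ord0 ord0) ord0 = ord0 :> CU by apply: val_inj.
rewrite /success /received_from /commanded /requested l0.
apply/seteqP; split=> w /=; first by case=> -[-> [-> ->]].
case/andP=> ->; case: beta; case: beta => //= _; first by left.
by right.
Qed.

(** Reset and increment merge into one affine recursion, because a success multiplies the old age by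
    0. *)
Lemma AoI_step (t : nat) (w : T) :
  (AoI beta gamma n k t.+1 w)%:R =
    1 + (AoI beta gamma n k t w)%:R * \1_(~` success t) w :> R.
Proof.
have successP : (w \in success t) =
    gamma n k t w && (beta ord0 n k t w (+) beta (lift ord0 ord0) n k t w).
  by rewrite successE; apply/idP/idP => [/set_mem|/mem_set].
rewrite /= !big_ord_recl big_ord0 /= addn0 indicE in_setC successP.
by case: gamma; case: beta; case: beta; rewrite /= ?mulr0 ?mulr1 ?addr0 ?nat1r.
Qed.

Lemma AoI_no_success (t : nat) (w : T) :
  (AoI beta gamma n k t w)%:R =
    \sum_(0 <= j < t.+1) \1_(no_success (t - j) j) w :> R.
Proof.
elim: t => [|t IH]; first by rewrite big_nat1 /= indicE in_setT.
(* The term j = 0 is the 1 of the recursion. A failure in slot t turns term j into term j + 1, whose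
   window still starts at t - j. *)
rewrite AoI_step IH [RHS]big_nat_recl //; congr (_ + _).
  by rewrite indicE in_setT.
rewrite big_distrl; apply: eq_big_nat => j jt.
by rewrite subSS no_successSr subnK // indicI.
Qed.

Lemma expectation_AoI (t : nat) :
  ('E_P[fun w => (AoI beta gamma n k t w)%:R])%E =
    (\sum_(0 <= j < t.+1) (1 - success_prob) ^+ j)%:E.
Proof.
rewrite unlock.
under eq_integral => w _ do rewrite AoI_no_success -sumEFin.
rewrite ge0_integral_sum //.
(* The probability of a window depends on its length j only, not on its start t - j. *)
- rewrite -sumEFin; apply: eq_bigr => j _.
  rewrite integral_indic // ?setIT; first exact: prob_no_success.
  exact: measurable_no_success.
- move=> j; apply/measurable_EFinP; apply: measurable_indic.
  exact: measurable_no_success.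
Qed.

End Reception.

(** * Time averages of partial geometric sums *)

Section TimeAverage.
Context {R : realType}.

(** This serves the case p = 0, where the expected age in slot t + 1 is t + 2. *)
Lemma sum_succ_succ (N : nat) :
  \sum_(0 <= t < N) t.+2%:R = 2^-1 * (N%:R * (N%:R + 3)) :> R.
Proof.
elim: N => [|N IH]; first by rewrite big_nil mul0r mulr0.
rewrite big_nat_recr //= IH -addn2 -(addn1 N) !natrD.
by field.
Qed.

Lemma time_average_geometric (p : R) : 0 <= p <= 1 ->
  (N%:R^-1 * \sum_(1 <= t < N.+1) \sum_(0 <= j < t.+1) (1 - p) ^+ j)%:E
    @[N --> \oo] --> (p%:E)^-1%E.
Proof.
case/andP=> p0 p1; rewrite inver; case: eqVneq => [->|pn0].
  (* For p = 0 the time average is (N + 3) / 2, which exceeds [A] once N >= 2 A. *)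
  apply/cvgeryP/cvgryPge => A; near=> N.
  have N0 : (0 < N)%N by near: N; exact: nbhs_infty_gt.
  have AN : A * 2 <= N%:R by near: N; exact: nbhs_infty_ger.
  rewrite big_add1 /=.
  under eq_bigr => t _.
    rewrite subr0; under eq_bigr do rewrite expr1n.
    rewrite big_const_nat subn0 iter_addr_0; over.
  rewrite /= sum_succ_succ mulrCA mulKf ?pnatr_eq0 -?lt0n //.
  by lra.
apply: cvg_EFin; first exact: nearW.
(* Slots are renumbered from 0: [u t] belongs to slot t + 1, whose sum has t + 2 terms. *)
pose u t : R := series (geometric 1 (1 - p)) t.+2.
have uE t : u t = \sum_(0 <= j < t.+2) (1 - p) ^+ j.
  by apply: eq_bigr => j _; rewrite /= mul1r.
have q1 : `|1 - p| < 1.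
  by rewrite ger0_norm ?subr_ge0// ltrBlDr ltrDl lt_neqAle eq_sym pn0.
have up : u @ \oo --> p^-1.
  have := @cvg_geometric_series R 1 _ q1.
  rewrite subKr div1r -(cvg_shiftn 2); apply: cvg_trans.
  by apply: near_eq_cvg; apply: nearW => t; rewrite /= addn2.
(* The arithmetic mean of index N averages N + 1 terms, hence the shift. *)
rewrite -cvg_shiftS; have := cesaro up; apply: cvg_trans.
apply: near_eq_cvg; apply: nearW => N /=.
rewrite /arithmetic_mean /= big_add1 /=; congr (_ * _).
by apply: eq_bigr => t _; rewrite uE.
Unshelve. all: by end_near.
Qed.

End TimeAverage.

(** * Summation over the four pairs of an eRRH and a CP *)

Theorem proposition1 (d : measure_display) (T : measurableType d)
    (R : realType) (P : probability T R)
    (beta : CU -> eRRH -> CP -> nat -> T -> bool)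
    (gamma : eRRH -> CP -> nat -> T -> bool)
    (b : CP -> eRRH -> R) (r : CP -> R)
    (policy : OSR_policy P beta gamma b r)
    (b_sum1 : forall k : CP, \sum_(n < 2) b k n = 1) :
  cvgn (mean_AoI P beta gamma) /\
  average_AoI P beta gamma =
    ((4^-1)%:E * ((2^-1)%:E *
      \sum_(n < 2) \sum_(k < 2) ((r k * zeta_c b n k)%:E)^-1))%E.
Proof.
pose M n k N : R := N%:R^-1 * \sum_(1 <= t < N.+1)
  \sum_(0 <= j < t.+1) (1 - success_prob b r n k) ^+ j.
have p01 n k : 0 <= success_prob b r n k <= 1.
  by rewrite (success_prob_ge0 policy) (success_prob_le1 policy).
(* The sum over the pairs is moved outside the time average, so that limits can be taken pair by
   pair. *)
have mean_AoIE : mean_AoI P beta gamma =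
    fun N => (\sum_(n < 2) \sum_(k < 2) ((4^-1)%:E * (M n k N)%:E))%E.
  apply/funext => N; rewrite /mean_AoI.
  under eq_bigr => t _.
    under eq_bigr => n _.
      under eq_bigr => k _ do rewrite (expectation_AoI policy).
      rewrite sumEFin; over.
    rewrite sumEFin -EFinM; over.
  rewrite sumEFin -EFinM.
  under [RHS]eq_bigr => n _.
    under eq_bigr => k _ do rewrite -EFinM.
    rewrite sumEFin; over.
  rewrite sumEFin /M; congr EFin.
  rewrite !big_ord_recl !big_ord0 !addr0.
  rewrite !(mulrA 4^-1) !(mulrC 4^-1) -!mulrA -!mulrDr; congr (_ * _).
  rewrite -big_distrr /=; congr (_ * _).
  rewrite -!big_split /=; apply: eq_bigr => t _.
  by rewrite !big_ord_recl !big_ord0 !addr0.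
have M_cvg n k : (M n k N)%:E @[N --> \oo] -->
    ((2^-1)%:E * ((r k * zeta_c b n k)%:E)^-1)%E.
  have := time_average_geometric (p01 n k).
  (* As the factor 2 is positive and finite, the inverse splits even when the other factor is 0. *)
  rewrite /success_prob EFinM inveM ?inver ?pnatr_eq0 //.
  by rewrite /inveM_def pnatr_eq0 ler0n implybT.
(* Some limits may be +oo; nonnegativity justifies distributing products over sums and adding
   limits. *)
have inv_ge0 n k : (0 <= ((r k * zeta_c b n k)%:E)^-1)%E.
  have /andP[+ _] := p01 n k.
  by rewrite inve_ge0 lee_fin /success_prob pmulr_rge0.
have M_ge0 n k N : 0 <= M n k N.
  rewrite mulr_ge0 ?invr_ge0 ?ler0n // sumr_ge0 // => t _.
  rewrite sumr_ge0 // => j _; rewrite exprn_ge0 // subr_ge0.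
  by case/andP: (p01 n k).
have cvg_mean : mean_AoI P beta gamma @ \oo -->
    ((4^-1)%:E * ((2^-1)%:E *
      \sum_(n < 2) \sum_(k < 2) ((r k * zeta_c b n k)%:E)^-1))%E.
  rewrite mean_AoIE ge0_sume_distrr => [|n _]; last exact: sume_ge0.
  rewrite ge0_sume_distrr => [|n _]; last first.
    by rewrite mule_ge0 ?lee_fin ?sume_ge0.
  apply: cvg_nnesum => n _.
    by apply: nearW => N; apply: sume_ge0 => k _; rewrite mule_ge0 ?lee_fin.
  rewrite ge0_sume_distrr // ge0_sume_distrr => [|k _]; last first.
    by rewrite mule_ge0 ?lee_fin.
  apply: cvg_nnesum => k _.
    by apply: nearW => N; rewrite mule_ge0 ?lee_fin.
  exact: cvgeZl.
split; first by apply/cvg_ex; eexists; exact: cvg_mean.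
exact/cvg_lim.
Qed.
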